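(* Let $n\geq 1$ be an integer. The number of tree-rooted plane cubic maps with $2n$ vertices in which the marked directed (root) edge does not belong to the marked spanning tree equals $C_{2n}\cdot C_{n+1}$, where $C_k=\frac{1}{k+1}\binom{2k}{k}$ is the $k$-th Catalan number.
   Context: A plane cubic map is a connected graph in which every vertex has degree three (loops and multiple edges are allowed, a loop contributing 2 to the degree), embedded in the plane (equivalently, the sphere); maps are considered up to orientation-preserving homeomorphism of the sphere. A tree-rooted plane cubic map is a plane cubic map together with (i) a marked spanning tree of the graph and (ii) a marked directed edge, i.e. an edge together with a choice of one of its two directions (for a loop, one of its two traversal directions), such that this edge does not belong to the marked spanning tree. Two tree-rooted maps are identified if an orientation-preserving homeomorphism of the sphere carries one map to the other, preserving the spanning tree and the directed root edge. *)

(* Defs.v *)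
From HB Require Import structures.
From mathcomp Require Import all_boot all_fingroup.

Set Implicit Arguments.
Unset Strict Implicit.
Unset Printing Implicit Defensive.

(* Combinatorial encoding of maps on closed oriented surfaces.  A dart is an
   edge together with one of its two directions (a loop has two darts).
   [rot] sends a dart to the next one in counterclockwise order around its
   origin, [opp] reverses a dart. *)
Record cmap := CMap {
  dart : finType;
  rot : {perm dart};
  opp : {perm dart};
  oppK : involutive opp;
  opp_neq : forall d, opp d != d
}.

Section Graph.
Variable M : cmap.
Implicit Types (d : dart M) (A : {set {set dart M}}).

(* A vertex is identified with the set of darts leaving it, so its cardinal is
   the degree (a loop counts twice); an edge with its pair of opposite darts. *)
Definition origin d : {set dart M} := porbit (rot M) d.
Definition target d : {set dart M} := origin (opp M d).
Definition edge d : {set dart M} := porbit (opp M) d.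

Definition vertices : {set {set dart M}} := porbits (rot M).
Definition edges : {set {set dart M}} := porbits (opp M).

(* [opp * rot] is [rot \o opp]: it traverses a dart, then turns at its end,
   thereby following the boundary of a face. *)
Definition faces : {set {set dart M}} := porbits (opp M * rot M)%g.

Definition adj A : rel {set dart M} := fun u v =>
  [exists d, [&& edge d \in A, origin d == u & target d == v]].

Definition connected_by A : Prop :=
  {in vertices &, forall u v, connect (adj A) u v}.

Definition connected_map : Prop := connected_by edges.

(* Euler's formula, which characterizes the sphere among closed connected
   oriented surfaces. *)
Definition planar : Prop := #|vertices| + #|faces| = #|edges| + 2.

Definition cubic : Prop := {in vertices, forall v : {set dart M}, #|v| = 3}.

(* The edges have to be distinct as well as the vertices, in order to exclude
   the closed walk [:: d; opp d]. *)
Definition graph_cycle (p : seq (dart M)) : bool :=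
  [&& p != [::], path.cycle [rel d d' | target d == origin d'] p,
      uniq [seq origin d | d <- p] & uniq [seq edge d | d <- p]].

Definition acyclic A : Prop :=
  forall p, graph_cycle p -> ~~ all (fun d => edge d \in A) p.

Definition spanning_tree A : Prop :=
  [/\ A \subset edges, connected_by A & acyclic A].

End Graph.

Record marked_map := MarkedMap {
  mmap :> cmap;
  mtree : {set {set dart mmap}};
  mroot : dart mmap
}.

Definition tree_rooted_plane_cubic (M : marked_map) : Prop :=
  [/\ connected_map M, planar M, cubic M,
      spanning_tree (mtree M) & edge (mroot M) \notin mtree M].

(* Commuting with [rot], rather than conjugating it to its inverse, expresses
   that orientation is preserved. *)
Definition marked_iso (M N : marked_map) : Prop :=
  exists f : dart M -> dart N,
    [/\ bijective f,
        forall d, f (rot M d) = rot N (f d),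
        forall d, f (opp M d) = opp N (f d),
        forall d, (edge (f d) \in mtree N) = (edge d \in mtree M)
      & f (mroot M) = mroot N].

(* There are exactly [k] classes up to isomorphism of marked maps satisfying
   [P]: [c] enumerates representatives without repetition. *)
Definition number_up_to_iso (P : marked_map -> Prop) (k : nat) : Prop :=
  exists c : 'I_k -> marked_map,
    [/\ forall i, P (c i),
        forall i j, marked_iso (c i) (c j) -> i = j
      & forall M, P M -> exists i, marked_iso M (c i)].

Definition catalan (k : nat) : nat := 'C(k.*2, k) %/ k.+1.

Lemma catalan_exact k : catalan k * k.+1 = 'C(k.*2, k).
Proof.
apply: divnK; rewrite -(Gauss_dvdr _ (coprimeSn k)).
have := mul_bin_left k.*2 k; rewrite -addnn addnK => <-.
exact: dvdn_mulr.
Qed.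

Lemma marked_iso_refl M : marked_iso M M.
Proof. by exists id; split=> //; exists id. Qed.

Lemma marked_iso_sym M N : marked_iso M N -> marked_iso N M.
Proof.
case=> f [[g fK gK] fr fo ft froot]; exists g; split.
- by exists f.
- by move=> d; apply: (can_inj fK); rewrite fr !gK.
- by move=> d; apply: (can_inj fK); rewrite fo !gK.
- by move=> d; rewrite -ft gK.
- by rewrite -froot fK.
Qed.

Lemma marked_iso_trans M N P :
  marked_iso M N -> marked_iso N P -> marked_iso M P.
Proof.
case=> f [bf fr fo ft froot] [g [bg gr go gt groot]]; exists (g \o f); split=> /=.
- exact: bij_comp.
- by move=> d; rewrite fr gr.
- by move=> d; rewrite fo go.
- by move=> d; rewrite gt ft.
- by rewrite froot.
Qed.

(* Main.v *)
(* Cutting the non-tree edges of a tree-rooted cubic map with 2n vertices turns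
   the spanning tree into a binary tree with 2n nodes, rooted at a leaf, and the
   map is recovered by matching the 2n + 2 leaves, which planarity forces to be
   noncrossing.

   To make this rigorous, let [flip] be [opp] on the darts of the tree and the
   identity elsewhere.  The permutation [flip * rot] walks around the tree: adding
   the tree edges one by one, each new transposition merges two cycles, so this
   walk is a single cycle.  Numbering the darts along it from the root, a map
   becomes a pair of involutions [(a, b)] of 'I_(6n) with complementary supports,
   [a = opp] on the tree and [b = opp] off it; then [rot] is [a] followed by the
   successor, and the faces are the cycles of [b] followed by the successor.  An
   involution with k two-cycles followed by the successor has k + 1 cycles iff
   it is noncrossing, so that [a] and [b] are both noncrossing.  Finally the [a]
   all of whose vertices have degree 3 are the contours of binary trees, and the
   [b] with given support correspond to Dyck words. *)

Require Import Defs.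
From HB Require Import structures.
From mathcomp Require Import all_boot all_fingroup.
From mathcomp Require Import zify.

Set Implicit Arguments.
Unset Strict Implicit.
Unset Printing Implicit Defensive.

(** * Binary trees and Catalan numbers *)

Inductive btree := Leaf | Node of btree & btree.

Lemma btree_comparable : comparable btree.
Proof. by move=> t u; rewrite /decidable; decide equality. Qed.

HB.instance Definition _ := hasDecEq.Build btree (compareP btree_comparable).

Fixpoint nodes t := if t is Node l r then (nodes l + nodes r).+1 else 0.

(** Inverse of splitting the root of the first tree. A nonempty forest either starts with a leaf or
    is the graft of a unique forest with one tree more and one node fewer. *)
Definition graft (f : seq btree) : seq btree :=
  if f is l :: r :: f' then Node l r :: f' else [::].

(* [k] is fuel: [m.*2 + h <= k] suffices to obtain all the forests of [h] trees
   with [m] nodes. *)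
Fixpoint forests k h m : seq (seq btree) :=
  match h, k with
  | 0, _ => if m == 0 then [:: [::]] else [::]
  | _, 0 => [::]
  | h'.+1, k'.+1 => map (cons Leaf) (forests k' h' m) ++
      (if m is m'.+1 then map graft (forests k' h.+1 m') else [::])
  end.

(** Deleting a first leaf and splitting a first root both lower [m.*2 + h] by one, in step with the
    fuel. *)
Lemma mem_forests k h m f : m.*2 + h <= k ->
  (f \in forests k h m) = (size f == h) && (sumn (map nodes f) == m).
Proof.
elim: k h m f => [|k IH] [|h] m f le_k; rewrite ?[forests _ _ _]/=.
- by case: m {le_k} => [|m]; case: f.
- by move: le_k; rewrite addnS.
- by case: m {le_k} => [|m]; case: f.
rewrite mem_cat; apply/orP/andP => [[|]|].
- case/mapP=> f'; rewrite IH; last lia.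
  by case/andP=> /eqP<- /eqP<- -> /=.
- case: m le_k => // m le_k; case/mapP=> f'; rewrite IH; last lia.
  by case: f' => [|l [|r f']] //= /andP[] /eqP[<-] /eqP<- -> /=; split=> //; lia.
case: f => [[]|[|l r] f [/= /eqP[sz] /eqP sm]] //.
  by left; apply/mapP; exists f; rewrite ?IH ?sz ?sm ?eqxx //; lia.
right; case: m le_k sm => // m le_k sm.
apply/mapP; exists (l :: r :: f) => //; rewrite IH; last lia.
by rewrite /= sz eqxx /=; lia.
Qed.

Lemma forests_uniq k h m : m.*2 + h <= k -> uniq (forests k h m).
Proof.
elim: k h m => [|k IH] [|h] m //= le_k; try by case: (m == 0).
rewrite cat_uniq map_inj_uniq ?IH /=; [|lia|by move=> x y []].
case: m le_k => // m le_k; apply/andP; split.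
  by apply/hasPn=> _ /mapP[[|l [|r f]] _ ->]; apply/negP=> /mapP[].
rewrite map_inj_in_uniq ?IH //; first lia.
move=> f g; rewrite !mem_forests; try lia.
case: f => [|l [|r f]] //; case: g => [|l' [|r' g]] // _ _ /=.
by case=> -> -> ->.
Qed.

Lemma size_forests0 k h : h <= k -> size (forests k h 0) = 1.
Proof.
elim: k h => [|k IH] [|h] //= le_k.
by rewrite cats0 size_map IH.
Qed.

(** The ballot formula, stated additively to avoid truncated subtraction; the recursion of [forests]
    becomes Pascal's rule. *)
Lemma size_forests k h m : m.+1.*2 + h <= k ->
  size (forests k h m.+1) + 'C(m.*2 + h + 1, m) = 'C(m.*2 + h + 1, m.+1).
Proof.
elim: k h m => [|k IH] [|h] m //= le_k.
  (* No tree can hold a node here, and the two binomials agree by symmetry. *)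
  rewrite addn0 addn1 add0n -bin_sub; last lia.
  by congr 'C(_, _); lia.
rewrite size_cat !size_map.
case: m le_k => [|m] le_k.
  rewrite size_forests0; last lia.
  have := IH h 0 ltac:(lia).
  by rewrite !bin0 !bin1; lia.
have := IH h m.+1 ltac:(lia); have := IH h.+2 m ltac:(lia).
have -> : m.+1.*2 + h + 1 = m.*2 + h.+2 + 1 by lia.
have -> : m.+1.*2 + h.+1 + 1 = (m.*2 + h.+2 + 1).+1 by lia.
by rewrite !binS; lia.
Qed.

Lemma size_forests1 k m : m.*2 < k -> size (forests k 1 m) = catalan m.
Proof.
move=> lt_k; case: m lt_k => [|m] lt_k.
  by rewrite size_forests0.
have := @size_forests k 1 m ltac:(lia).
have -> : m.*2 + 1 + 1 = m.+1.*2 by lia.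
have := catalan_exact m.+1.
have := mul_bin_left m.+1.*2 m.
have -> : m.+1.*2 - m = m.+2 by lia.
set x := 'C(_, _); set y := 'C(_, _) => e1 e2 e3.
(* Multiplying by [m.+2] clears the division in [catalan]. *)
have : (size (forests k 1 m.+1)) * m.+2 = catalan m.+1 * m.+2 by nia.
by move/eqP; rewrite eqn_pmul2r // => /eqP.
Qed.

(** The forests listed here have exactly one tree, so the default [Leaf] of [head] is never
    returned. *)
Definition trees m := map (head Leaf) (forests m.*2.+1 1 m).

Lemma size_trees m : size (trees m) = catalan m.
Proof. by rewrite size_map size_forests1. Qed.

Lemma mem_trees m t : (t \in trees m) = (nodes t == m).
Proof.
apply/mapP/eqP => [[f]|<-].
  rewrite mem_forests ?addn1 // => /andP[/eqP sz /eqP <-] ->.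
  by case: f sz => [|u []] //= _; rewrite addn0.
by exists [:: t]; rewrite // mem_forests ?addn1 //= addn0 eqxx.
Qed.

Lemma trees_uniq m : uniq (trees m).
Proof.
rewrite map_inj_in_uniq ?forests_uniq ?addn1 //.
move=> f g; rewrite !mem_forests ?addn1 // => /andP[/eqP sf _] /andP[/eqP sg _].
by case: f sf => [|x []] // _; case: g sg => [|y []] //= _ ->.
Qed.

(** Transfers the count of trees along a one-to-one relation. With a relation, decoding only has to
    be shown to exist, not to be written as a function. *)
Lemma card_trees_in_bij (T : finType) (A : {set T}) (m : nat)
    (R : btree -> T -> Prop) :
    (forall t, nodes t = m -> exists2 a, a \in A & R t a) ->
    {in A, forall a, exists2 t, nodes t = m & R t a} ->
    (forall t a b, R t a -> R t b -> a = b) ->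
    (forall t u a, nodes t = m -> nodes u = m -> R t a -> R u a -> t = u) ->
  #|A| = catalan m.
Proof.
move=> exA exT funR injR.
(* A decoding is chosen for the whole finite type; outside [A] its value is arbitrary. *)
have /fin_all_exists[v vP] :
    forall a : T, exists t, a \in A -> nodes t = m /\ R t a.
  move=> a; case: (boolP (a \in A)) => [/exT[t]|_]; last by exists Leaf.
  by move=> mt Ra; exists t.
rewrite -size_trees cardE -(size_map v); apply: perm_size; apply: uniq_perm.
- rewrite map_inj_in_uniq ?enum_uniq // => a b; rewrite !mem_enum.
  by move=> /vP[_ Ra] /vP[_ Rb] e; apply: funR Ra _; rewrite e.
- exact: trees_uniq.
move=> t; rewrite mem_trees; apply/mapP/eqP => [[a]|mt].
  by rewrite mem_enum => /vP[<- _] ->.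
have [a aA Ra] := exA t mt; exists a; rewrite ?mem_enum //.
by have [mv Rv] := vP a aA; apply: injR Ra Rv.
Qed.

(** * Contours of binary trees and Dyck words *)

Definition involutive_below L (e : nat -> nat) :=
  forall i, i < L -> e i < L /\ e (e i) = i.

Definition noncrossing_below L (e : nat -> nat) :=
  forall i j, i < L -> i < j -> j < e i -> i < e j < e i.

(** The map sending [i] to [(e i).+1] is the rotation around vertices: its third power is the
    identity and it has no fixed point. Position 0 is left out because in a contour its mate is the
    last position, which has no successor. *)
Definition cubic_below L (e : nat -> nat) :=
  forall i, 0 < i < L -> (e (e (e i).+1).+1).+1 = i /\ (e i).+1 <> i.

Fixpoint tlen t := if t is Node l r then (tlen l + tlen r).+2 else 1.

Lemma tlen_gt0 t : 0 < tlen t. Proof. by case: t. Qed.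

Lemma tlenE t : tlen t = (3 * nodes t).+1.
Proof. by elim: t => //= l -> r ->; lia. Qed.

(* The contour word of [t] is [l] for a leaf and [( w1 w2 )] for a node;
   [tmate t] matches its parentheses and fixes its letters [l]. *)
Fixpoint tmate t i :=
  if t is Node l r then
    if i is i'.+1 then
      if i' < tlen l then (tmate l i').+1
      else if i' < tlen l + tlen r then (tmate r (i' - tlen l) + tlen l).+1
      else 0
    else (tlen l + tlen r).+1
  else 0.

Lemma tmate0 t : tmate t 0 = (tlen t).-1. Proof. by case: t. Qed.

Lemma tmate_inv t : involutive_below (tlen t) (tmate t).
Proof.
elim: t => [|l IHl r IHr] [|i] //=; try lia.
  by move=> _; rewrite !ifF; lia.
move=> lt_i; case: (ltnP i (tlen l)) => [lt_il|le_li].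
  by have [lt_m ->] := IHl i lt_il; rewrite /= lt_m; lia.
case: (ltnP i (tlen l + tlen r)) => [lt_ir|le_ri]; last by split=> //=; lia.
have [lt_m e_m] := IHr (i - tlen l) ltac:(lia).
rewrite ifF; last lia.
by rewrite ifT ?addnK ?e_m; lia.
Qed.

Lemma tmate_nc t : noncrossing_below (tlen t) (tmate t).
Proof.
elim: t => [|l IHl r IHr] i j //=.
case: i => [|i] lt_i; case: j => [|j] //= lt_ij.
  case: (ltnP j (tlen l)) => [lt_jl|le_lj].
    by have [] := tmate_inv lt_jl; lia.
  case: (ltnP j (tlen l + tlen r)) => [lt_jr|]; last lia.
  by have [|] := @tmate_inv r (j - tlen l); lia.
case: (ltnP i (tlen l)) => [lt_il|le_li].
  have [lt_m _] := tmate_inv lt_il.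
  move=> lt_j; rewrite ifT; last lia.
  by have := IHl i j lt_il ltac:(lia) ltac:(lia); lia.
case: (ltnP i (tlen l + tlen r)) => [lt_ir|le_ri] //.
have [|lt_m _] := @tmate_inv r (i - tlen l); first lia.
move=> lt_j; rewrite ifF; last lia.
rewrite ifT; last lia.
by have := IHr (i - tlen l) (j - tlen l) ltac:(lia) ltac:(lia) ltac:(lia); lia.
Qed.

(** The last position is already the mate of 0, and an involution is injective. *)
Lemma tmate_lt_last t i : 0 < i < tlen t -> tmate t i < (tlen t).-1.
Proof.
case/andP=> i_gt0 lt_i; have [lt_m e_m] := tmate_inv lt_i.
rewrite ltn_neqAle; apply/andP; split; last lia.
apply/eqP=> e; move: e_m; rewrite e -tmate0.
by have [] := @tmate_inv t 0 (tlen_gt0 t) => _ ->; lia.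
Qed.

Lemma tmate_node_l l r i : i < tlen l -> tmate (Node l r) i.+1 = (tmate l i).+1.
Proof. by move=> /= ->. Qed.

Lemma tmate_node_r l r i : i < tlen r ->
  tmate (Node l r) (i + tlen l).+1 = (tmate r i + tlen l).+1.
Proof.
by move=> /= lt_i; rewrite ifF ?ifT ?addnK //; lia.
Qed.

Lemma tmate_node_last l r : tmate (Node l r) (tlen l + tlen r).+1 = 0.
Proof. by rewrite /= ifF ?ifF //; lia. Qed.

(** The beginnings of the two subtrees and the final parenthesis form one cycle of length three, the
    vertex of the root node. All other positions lie inside a subtree and are handled by
    induction. *)
Lemma tmate_cubic t : cubic_below (tlen t) (tmate t).
Proof.
elim: t => [|l IHl r IHr] i; first by rewrite /=; lia.
have l0 := tlen_gt0 l; have r0 := tlen_gt0 r.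
have e0 : tmate (Node l r) 1 = tlen l by rewrite tmate_node_l // tmate0; lia.
have e1 : tmate (Node l r) (tlen l).+1 = tlen l + tlen r.
  by rewrite -{1}[tlen l]add0n tmate_node_r // tmate0; lia.
have e2 := tmate_node_last l r.
case/andP=> i_gt0 lt_i.
have [->|ne1] := eqVneq i 1; first by rewrite e0 e1 e2; lia.
have [->|ne2] := eqVneq i (tlen l).+1; first by rewrite e1 e2 e0; lia.
have [->|ne3] := eqVneq i (tlen l + tlen r).+1; first by rewrite e2 e0 e1; lia.
have [lt_il|le_li] := ltnP i.-1 (tlen l).
  have [E ne] := IHl i.-1 ltac:(lia).
  have h1 := @tmate_lt_last l i.-1 ltac:(lia).
  have h2 := @tmate_lt_last l (tmate l i.-1).+1 ltac:(lia).
  by rewrite -[i](@prednK i) // !tmate_node_l; lia.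
have lt_ir : i.-1 - tlen l < tlen r by move: lt_i => /=; lia.
have [E ne] := IHr (i.-1 - tlen l) ltac:(lia).
have h1 := @tmate_lt_last r (i.-1 - tlen l) ltac:(lia).
have h2 := @tmate_lt_last r (tmate r (i.-1 - tlen l)).+1 ltac:(lia).
have -> : i = (i.-1 - tlen l + tlen l).+1 by lia.
rewrite tmate_node_r // -addSn tmate_node_r; last lia.
by rewrite -addSn tmate_node_r; lia.
Qed.

(** The mate of position 1 is the end of the left subtree, which determines where the word
    splits. *)
Lemma tmate_inj t u : tlen t = tlen u ->
  (forall i, i < tlen t -> tmate t i = tmate u i) -> t = u.
Proof.
elim: t u => [|l IHl r IHr] [|l' r'] //=; try lia.
have l0 := tlen_gt0 l; have l0' := tlen_gt0 l'.
move=> [] e_len e_mate.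
have e_l : tlen l = tlen l'.
  by have := e_mate 1 ltac:(lia); rewrite l0 l0' !tmate0; lia.
rewrite (IHl l') //; last first.
  move=> i lt_i; have := e_mate i.+1 ltac:(lia).
  by rewrite -e_l lt_i => -[].
rewrite (IHr r') //; first lia.
move=> i lt_i.
have : tmate (Node l r) (i + tlen l).+1 = tmate (Node l' r') (i + tlen l).+1.
  by apply: (e_mate (i + tlen l).+1); lia.
by rewrite tmate_node_r // e_l tmate_node_r; lia.
Qed.

(** Induction on the length of the arc from [p] to [q]. With [m = e p.+1], the cubic condition at
    [q] says that [m.+1] is matched with [q.-1], so the inside of the arc is exactly two consecutive
    arcs, the two subtrees. *)
Lemma tmate_decode L e : involutive_below L e -> noncrossing_below L e ->
    cubic_below L e ->
  forall p q, p <= q < L -> e p = q ->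
  exists2 t, tlen t = (q - p).+1 &
    forall i, i < tlen t -> e (p + i) = p + tmate t i.
Proof.
move=> einv enc ecub p q; have [k] := ubnP (q - p).
elim: k p q => // k IH p q le_k /andP[le_pq lt_q] epq.
have [eqpq|ne_pq] := eqVneq p q.
  exists Leaf; first by rewrite eqpq subnn.
  by case=> //= _; rewrite !addn0; lia.
have eqp : e q = p by have [] := einv p ltac:(lia); rewrite epq.
have [cub_q cub_q'] := ecub q ltac:(lia).
rewrite eqp in cub_q cub_q'.
have [lt1 inv1] := einv p.+1 ltac:(lia).
have nc1 := enc p p.+1 ltac:(lia) (leqnn _) ltac:(lia).
move: lt1 inv1 nc1 cub_q; set m := e p.+1 => lt1 inv1 nc1 cub_q.
(* If the first inner arc filled the inside, the rotation would fix [q]. *)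
have [e_mq|ne_mq] := eqVneq m.+1 q.
  by move: cub_q; rewrite e_mq eqp; lia.
have e2 : e m.+1 = q.-1 by lia.
have [l el lP] := IH p.+1 m ltac:(lia) ltac:(lia) (erefl _).
have [r er rP] := IH m.+1 q.-1 ltac:(lia) ltac:(lia) e2.
exists (Node l r) => [|i]; first by rewrite /=; lia.
case: i => [|i] lt_i; first by rewrite addn0 epq /=; lia.
move: lt_i => /= lt_i; case: (ltnP i (tlen l)) => [lt_il|le_li].
  by rewrite addnS -addSn lP //; lia.
case: (ltnP i (tlen l + tlen r)) => [lt_ir|le_ri].
  have -> : p + i.+1 = m.+1 + (i - tlen l) by lia.
  by rewrite rP; lia.
have -> : p + i.+1 = q by lia.
by rewrite eqp addn0.
Qed.

(* [dmate u] matches the parentheses of the Dyck word [( w1 ) w2] of [u]. *)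
Fixpoint dmate u i :=
  if u is Node l r then
    if i is i'.+1 then
      if i' < (nodes l).*2 then (dmate l i').+1
      else if i' == (nodes l).*2 then 0
      else dmate r (i' - (nodes l).*2.+1) + (nodes l).*2.+2
    else (nodes l).*2.+1
  else 0.

Lemma dmate_inv u : involutive_below (nodes u).*2 (dmate u).
Proof.
elim: u => [|l IHl r IHr] [|i] //=.
  by move=> _; rewrite ltnn eqxx; lia.
move=> lt_i; case: (ltnP i (nodes l).*2) => [lt_il|le_li].
  by have [lt_m ->] := IHl i lt_il; rewrite /= lt_m; lia.
case: eqP => [->|ne]; first by rewrite /=; lia.
have [lt_m e_m] := IHr (i - (nodes l).*2.+1) ltac:(lia).
rewrite addnS ifF; last lia.
rewrite ifF; last lia.
by rewrite addnK; lia.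
Qed.

Lemma dmate_nofix u i : i < (nodes u).*2 -> dmate u i <> i.
Proof.
elim: u i => [|l IHl r IHr] [|i] //= lt_i.
case: (ltnP i (nodes l).*2) => [lt_il|le_li]; first by have := IHl i lt_il; lia.
case: eqP => // ne.
by have := IHr (i - (nodes l).*2.+1) ltac:(lia); lia.
Qed.

Lemma dmate_nc u : noncrossing_below (nodes u).*2 (dmate u).
Proof.
elim: u => [|l IHl r IHr] i j //=.
case: i => [|i] lt_i; case: j => [|j] //= lt_ij.
  move=> lt_j; rewrite ifT; last lia.
  by have [] := @dmate_inv l j; lia.
case: (ltnP i (nodes l).*2) => [lt_il|le_li].
  have [lt_m _] := dmate_inv lt_il.
  move=> lt_j; rewrite ifT; last lia.
  by have := IHl i j lt_il ltac:(lia) ltac:(lia); lia.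
case: eqP => // ne lt_j.
have [|lt_m _] := @dmate_inv r (i - (nodes l).*2.+1); first lia.
rewrite ifF; last lia.
rewrite ifF; last lia.
by have := IHr (i - (nodes l).*2.+1) (j - (nodes l).*2.+1) ltac:(lia) ltac:(lia)
  ltac:(lia); lia.
Qed.

Lemma dmate_inj t u : nodes t = nodes u ->
  (forall i, i < (nodes t).*2 -> dmate t i = dmate u i) -> t = u.
Proof.
elim: t u => [|l IHl r IHr] [|l' r'] //= [] e_n e_mate.
have e_l : nodes l = nodes l'.
  by have := e_mate 0 ltac:(lia); rewrite /=; lia.
rewrite (IHl l') //; last first.
  move=> i lt_i; have := e_mate i.+1 ltac:(lia).
  by rewrite -e_l lt_i => -[].
rewrite (IHr r') //; first lia.
move=> i lt_i; have := e_mate (i + (nodes l).*2.+2) ltac:(lia).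
rewrite -e_l addnS !ifF; try lia.
by rewrite addnK; lia.
Qed.

(** First-return decomposition of a stable interval at [m = e p]. The part enclosed by the arc is
    stable because nothing crosses it; the part after [m] is stable because an image inside the arc
    would be sent back inside it. *)
Lemma dmate_decode L e : involutive_below L e -> noncrossing_below L e ->
    (forall i, i < L -> e i <> i) ->
  forall p q, p <= q <= L -> (forall i, p <= i < q -> p <= e i < q) ->
  exists2 u, (nodes u).*2 = q - p &
    forall i, i < q - p -> e (p + i) = p + dmate u i.
Proof.
move=> einv enc enf p q; have [k] := ubnP (q - p).
elim: k p q => // k IH p q le_k /andP[le_pq lt_q] est.
have [eqpq|ne_pq] := eqVneq p q.
  by exists Leaf => [|i]; rewrite eqpq subnn.
have := est p ltac:(lia); have := enf p ltac:(lia).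
have [_] := einv p ltac:(lia); have {}enc := enc p.
set m := e p in enc * => emp ne_mp lt_m.
have [||i lt_i|l el lP] := IH p.+1 m; try lia.
  by have := enc i; lia.
have [||i lt_i|r er rP] := IH m.+1 q; try lia.
  have := est i ltac:(lia); have [_ eei] := einv i ltac:(lia).
  have [ep|] := eqVneq (e i) p; first by move: eei; rewrite ep -/m; lia.
  have [em|] := eqVneq (e i) m; first by move: eei; rewrite em emp; lia.
  have [lt_eim|] := ltnP (e i) m; last lia.
  by move=> _ ne_p /andP[lt_p _]; have := enc (e i); rewrite eei; lia.
exists (Node l r) => [|i]; first by rewrite /=; lia.
case: i => [|i] lt_i; first by rewrite addn0 /= -/m; lia.
move: lt_i => /= lt_i; case: (ltnP i (nodes l).*2) => [lt_il|le_li].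
  by rewrite addnS -addSn lP //; lia.
case: eqP => [ei|ne].
  have -> : p + i.+1 = m by lia.
  by rewrite emp addn0.
have -> : p + i.+1 = m.+1 + (i - (nodes l).*2.+1) by lia.
by rewrite rP; lia.
Qed.

(** * Noncrossing involutions *)

Section Porbits.
Variable T : finType.
Implicit Types (s t : {perm T}) (x y z : T).
Local Open Scope group_scope.

Definition moved s : {set T} := [set x | s x != x].

Lemma porbit_perm1 s x : porbit s (s x) = porbit s x.
Proof. by have := porbit_perm s 1 x; rewrite expg1. Qed.

Lemma mem_porbits s x : porbit s x \in porbits s.
Proof. exact: imset_f. Qed.

Lemma porbit_ind s (P : T -> Prop) x :
  P x -> (forall y, P y -> P (s y)) -> {in porbit s x, forall y, P y}.
Proof.
move=> Px Ps _ /porbitP[i ->]; elim: i => [|i IHi]; first by rewrite perm1.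
by rewrite expgSr permM; apply: Ps.
Qed.

Lemma porbit_closed (X : Type) s (A : T -> X) x y :
  (forall z, A (s z) = A z) -> x \in porbit s y -> A x = A y.
Proof.
by move=> As; apply: (@porbit_ind s (fun x => A x = A y)) => // z <-.
Qed.

Lemma card_porbits_tperm s x y :
  #|porbits (tperm x y * s)| + (x \notin porbit s y).*2
    = #|porbits s| + (x != y).
Proof. exact: porbits_mul_tperm. Qed.

(* Applying the cycle count to both [t] and [tperm x y * t] shows that a
   transposition merging two cycles puts its ends in the same cycle. *)
Lemma porbit_merge t x y (t' : {perm T} := tperm x y * t) : x \notin porbit t y ->
  [/\ #|porbits t'|.+1 = #|porbits t|, porbit t' x = porbit t' y
    & forall z, porbit t' (t z) = porbit t' z].
Proof.
move=> nxy; have ne_xy : x != y by apply: contraNneq nxy => ->; exact: porbit_id.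
have := card_porbits_tperm t x y; have := card_porbits_tperm t' x y.
rewrite /= mulgA tperm2 mul1g -/t' nxy ne_xy.
case: (boolP (x \in porbit t' y)) => [xy _ e|_]; last lia.
have Exy : porbit t' x = porbit t' y by apply/eqP; rewrite eq_porbit_mem.
split=> // [|z]; first lia.
rewrite -[t z](_ : t' (tperm x y z) = _); last by rewrite permM tpermK.
by rewrite porbit_perm1; case: tpermP => [->|->|].
Qed.

(** * Removal of a two-cycle from an involution *)

Section Cut.
Variables (s : {perm T}) (x : T).
Hypotheses (sK : involutive s) (sx : s x != x).

Definition cut := tperm x (s x) * s.

Lemma cutE y : cut y = if (y == x) || (y == s x) then y else s y.
Proof.
rewrite permM; case: tpermP => [->|->|/eqP/negPf-> /eqP/negPf->] //.
  by rewrite sK eqxx.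
by rewrite eqxx orbT.
Qed.

Lemma cutK : involutive cut.
Proof.
move=> y; rewrite !cutE.
case: (boolP ((y == x) || _)) => [->|/norP[yx ysx]] //.
by rewrite (inj_eq perm_inj) -{1}[x]sK (inj_eq perm_inj) (negPf yx) (negPf ysx) sK.
Qed.

Lemma tperm_cut t : tperm x (s x) * (cut * t) = s * t.
Proof. by rewrite !mulgA tperm2 mul1g. Qed.

(** The transposition commutes with the rest of the involution, so it can also be placed next to
    [t]. *)
Lemma cut_tperm t : cut * (tperm x (s x) * t) = s * t.
Proof.
rewrite mulgA; congr (_ * _); apply/permP=> y; rewrite permM cutE.
have [->|nyx] := eqVneq y x; first by rewrite tpermL.
have [->|nysx] := eqVneq y (s x); first by rewrite tpermR sK.
rewrite tpermD //; first by rewrite -{1}[x]sK (inj_eq perm_inj) eq_sym.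
by rewrite (inj_eq perm_inj) eq_sym.
Qed.

Lemma moved_cut : #|moved s| = #|moved cut| + 2.
Proof.
have -> : moved cut = moved s :\: [set x; s x].
  by apply/setP=> y; rewrite !inE cutE; case: ifP; rewrite ?eqxx.
rewrite cardsD (setIidPr _); last first.
  by apply/subsetP=> y; rewrite !inE => /orP[] /eqP-> //; rewrite sK eq_sym.
rewrite cards2 eq_sym sx subnK //.
have -> : 2 = #|[set x; s x]| by rewrite cards2 eq_sym sx.
apply/subset_leq_card/subsetP=> y; rewrite !inE => /orP[] /eqP-> //.
by rewrite sK eq_sym.
Qed.

End Cut.

Lemma moved0 s : moved s = set0 -> s = 1.
Proof.
move=> s0; apply/permP=> x; rewrite perm1; apply/eqP.
by have := in_set0 x; rewrite -s0 inE => /negbFE.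
Qed.

(** Each two-cycle of [s] contributes one transposition, which creates at most one new cycle. *)
Lemma porbits_invol_le s t : involutive s ->
  #|porbits (s * t)|.*2 <= #|porbits t|.*2 + #|moved s|.
Proof.
have [k] := ubnP #|moved s|; elim: k s => // k IH s le_k sK.
have [s0|[x]] := set_0Vmem (moved s); first by rewrite (moved0 s0) mul1g; lia.
rewrite inE => sx; have := moved_cut sK sx.
have := IH (cut s x) ltac:(rewrite (moved_cut sK sx) in le_k; lia) (cutK x sK).
have := card_porbits_tperm (cut s x * t) x (s x).
by rewrite tperm_cut eq_sym sx /=; case: (_ \notin _) => /=; lia.
Qed.

End Porbits.

(** * Noncrossing involutions and the number of cycles *)

Section Noncrossing.
Variable N : nat.
Implicit Types (s : {perm 'I_N.+1}) (i j l m x : 'I_N.+1).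

Definition noncrossing s :=
  [forall i : 'I_N.+1, forall j : 'I_N.+1, (i < j < s i) ==> (i < s j < s i)].

Lemma noncrossingP s :
  reflect (forall i j, i < j -> j < s i -> i < s j < s i) (noncrossing s).
Proof.
apply: (iffP forallP) => [H i j ij js|H i].
  by have /forallP/(_ j)/implyP := H i; apply; rewrite ij.
by apply/forallP=> j; apply/implyP=> /andP[]; apply: H.
Qed.

Definition succp : {perm 'I_N.+1} := perm (@ordS_inj N.+1).

Lemma succpE i : succp i = i.+1 %% N.+1 :> nat.
Proof. by rewrite permE. Qed.

Lemma succp_lt i : i < N -> succp i = i.+1 :> nat.
Proof. by move=> lt_i; rewrite succpE modn_small. Qed.

Lemma succp_max i : i = N :> nat -> succp i = 0 :> nat.
Proof. by move=> e; rewrite succpE e modnn. Qed.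

Lemma succp_iter (i : nat) : iter i succp ord0 = i %% N.+1 :> nat.
Proof.
elim: i => [|i IHi]; first by rewrite mod0n.
by rewrite iterS succpE IHi -addn1 modnDml addn1.
Qed.

Lemma succp_iterE i : iter i succp ord0 = i.
Proof. by apply: val_inj; rewrite /= succp_iter modn_small. Qed.

Lemma porbits_succp : #|porbits succp| = 1.
Proof.
have E i : porbit succp i = porbit succp ord0.
  by rewrite -[i]succp_iterE -permX porbit_perm.
rewrite (_ : porbits succp = [set porbit succp ord0]) ?cards1 //.
apply/setP=> A; rewrite inE; apply/imsetP/eqP => [[i _ ->]|->]; first exact: E.
by exists ord0.
Qed.

(* Multiplying the long cycle by a transposition cuts off an interval. *)
Lemma tperm_succp_interval l m x : l < m ->
  (l < succp (tperm l m x) <= m) = (l < x <= m).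
Proof.
move=> lm; have lt_m := ltn_ord m; have [lt_y|le_y] := ltnP (tperm l m x) N; last first.
  rewrite succp_max; last by have := ltn_ord (tperm l m x); lia.
  move: le_y; case: tpermP => [->|->|/eqP ne1 /eqP ne2]; try lia.
  by move: ne2; rewrite -val_eqE /=; lia.
rewrite succp_lt //; case: tpermP lt_y => [->|->|/eqP ne1 /eqP ne2]; try lia.
by move: ne1 ne2; rewrite -!val_eqE /=; lia.
Qed.

Lemma noncrossing_cut s l : involutive s -> s l != l -> noncrossing s ->
  noncrossing (cut s l).
Proof.
move=> sK sl /noncrossingP nc; apply/noncrossingP=> i j.
rewrite !cutE //; case: ifP => [|/norP[il isl]] ij; first lia.
move=> ji; case: ifP => [|_]; last exact: nc.
by move=> /orP[] /eqP e; move: ij ji; rewrite e; lia.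
Qed.

(** Removing an innermost arc loses exactly one cycle; after all arcs are gone the single cycle of
    [succp] remains. *)
Lemma noncrossing_porbits s : involutive s -> noncrossing s ->
  #|porbits (s * succp)|.*2 = #|moved s| + 2.
Proof.
have [k] := ubnP #|moved s|; elim: k s => // k IH s le_k sK nc.
have [s0|[x]] := set_0Vmem (moved s).
  by rewrite (moved0 s0) mul1g porbits_succp -(moved0 s0) s0 cards0.
rewrite inE => sx.
have [y sy] : exists y : 'I_N.+1, s y < y.
  have [|] := ltnP (s x) x; first by exists x.
  by exists (s x); rewrite sK; move: sx; rewrite -val_eqE /=; lia.
(* The arc ending at the leftmost closing end [m] encloses only fixed points. *)
have [m lt_m min_m] : exists2 m : 'I_N.+1, s m < m & forall j, s j < j -> m <= j.
  by case: (arg_minnP (P := fun y : 'I_N.+1 => s y < y) val sy) => m; exists m.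
have [l sl lm] : exists2 l : 'I_N.+1, s l = m & l < m by exists (s m).
have ne_l : s l != l by rewrite sl neq_ltn lm orbT.
have fix_lm j : l < j < m -> s j = j.
  move=> /andP[lj jm]; have := (noncrossingP _ nc) l j lj.
  rewrite sl => /(_ jm) sj; apply: val_inj => /=.
  have := min_m j; have := min_m (s j); rewrite sK; lia.
have cut_lm j : l <= j < m -> cut s l j = j.
  move=> lj; rewrite cutE //; case: ifP => // /norP[jl _].
  by apply: fix_lm; move: jl; rewrite -val_eqE /=; lia.
(* Once the arc is cut, successive steps lead from [l] to [m]; restoring the transposition therefore
   splits their common cycle in two. *)
have same : m \in porbit (cut s l * succp) l.
  have E d : l + d <= m -> iter d (cut s l * succp)%g l = l + d :> nat.
    elim: d => [|d IHd] le_d; first by rewrite addn0.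
    have {}IHd := IHd ltac:(lia).
    rewrite iterS permM cut_lm; last by rewrite IHd; lia.
    by rewrite succp_lt IHd; have := ltn_ord m; lia.
  apply/porbitP; exists (m - l); rewrite permX; apply: val_inj => /=.
  by rewrite E; lia.
have := card_porbits_tperm (cut s l * succp)%g l (s l).
rewrite tperm_cut sl porbit_sym same /=.
have := moved_cut sK ne_l.
have := IH (cut s l) ltac:(rewrite (moved_cut sK ne_l) in le_k; lia)
  (cutK l sK) (noncrossing_cut sK ne_l nc).
by have -> : l != m; rewrite -?val_eqE /=; lia.
Qed.

(** Suppose the arcs of [i] and [j] cross. The first splits the cycle of [succp] in two, and the
    second joins the pieces again. The remaining arcs add at most one cycle each, so the total falls
    two short. *)
Lemma porbits_noncrossing s : involutive s ->
  #|porbits (s * succp)|.*2 = #|moved s| + 2 -> noncrossing s.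
Proof.
move=> sK cnt; apply/noncrossingP=> i j ij ji; apply/negPn/negP=> out.
have si : s i != i by rewrite -val_eqE /=; lia.
have nji : j != i by rewrite -val_eqE /=; lia.
have njsi : j != s i by rewrite -val_eqE /=; lia.
have sjsi : s j != s i by rewrite (inj_eq perm_inj).
have ci : cut s i j = s j by rewrite cutE // (negPf nji) (negPf njsi).
have cj : cut s i j != j.
  by rewrite ci; apply: contraNneq out => ->; rewrite ij.
have cK := cutK i sK.
(* The interval from [i] (excluded) to [s i] (included) is a union of cycles, and it contains [j]
   but not [s j]. *)
have nin : j \notin porbit (tperm i (s i) * succp) (s j).
  apply/negP=> jin; have E : (i < j <= s i) = (i < s j <= s i).
    apply: (porbit_closed (A := fun x : 'I_N.+1 => i < x <= s i)) jin => x.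
    by rewrite permM tperm_succp_interval //; lia.
  by move: out sjsi; rewrite -val_eqE /=; lia.
have [] := porbit_merge nin.
have := card_porbits_tperm succp i (s i).
rewrite /= porbits_succp eq_sym si /=.
have := moved_cut sK si; have := moved_cut cK cj.
have := @porbits_invol_le _ (cut (cut s i) j)
  (tperm j (cut s i j) * (tperm i (s i) * succp))%g (cutK j cK).
rewrite !cut_tperm // ci => h1 h2 h3 h4 h5 _ _.
move: h1 h4 h5; rewrite cnt h3 h2.
by set p := #|_ _|; set q := #|porbits (tperm i _ * _)%g|; set z := #|_ _|; lia.
Qed.

End Noncrossing.

(** * Counting pairs of involutions *)

Lemma porbits_partition (T : finType) (s : {perm T}) : partition (porbits s) setT.
Proof.
have -> : porbits s = preim_partition (porbit s) [set: T].
  apply/setP=> A; apply/imsetP/imsetP => -[x _ ->]; exists x => //.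
    by apply/setP=> y; rewrite !inE /= eq_porbit_mem porbit_sym.
  by apply/setP=> y; rewrite !inE /= eq_porbit_mem porbit_sym.
exact: preim_partitionP.
Qed.

Lemma card_porbits_uniform (T : finType) (s : {perm T}) k :
  (forall x, #|porbit s x| = k) -> #|T| = #|porbits s| * k.
Proof.
move=> card_k; rewrite -cardsT.
apply: card_uniform_partition (porbits_partition s) => _ /imsetP[x _ ->].
exact: card_k.
Qed.

(** Turns degree three into conditions on iterates, the form used by [cubic_below]. *)
Lemma card_porbit_eq3 (T : finType) (s : {perm T}) x :
  (#|porbit s x| == 3) = (iter 3 s x == x) && (s x != x).
Proof.
apply/eqP/andP => [c3|[/eqP s3 sx]].
  have := iter_porbit s x; rewrite c3 => ->; split=> //.
  have := uniq_traject_porbit s x; rewrite c3 /= !inE negb_or eq_sym.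
  by case/andP=> /andP[].
have sxx : s (s x) != x by apply: contraNneq sx => e; rewrite -{2}s3 /= e.
have ssx : s (s x) != s x by rewrite (inj_eq perm_inj).
have -> : porbit s x = x |: [set s x; s (s x)].
  apply/setP=> y; rewrite !inE; apply/idP/idP; last first.
    case/or3P=> /eqP->; first exact: porbit_id.
      by rewrite -{1}[s x]/(iter 1 s x) -permX mem_porbit.
    by rewrite -{1}[s (s x)]/(iter 2 s x) -permX mem_porbit.
  apply: (@porbit_ind _ s (fun y => [|| y == x, y == s x | y == s (s x)])).
    by rewrite eqxx.
  move=> z /or3P[] /eqP->; rewrite ?eqxx ?orbT //.
  by rewrite -[s (s (s x))]/(iter 3 s x) s3 eqxx.
by rewrite cardsU1 cards2 !inE negb_or eq_sym sx [x == s _]eq_sym sxx eq_sym ssx.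
Qed.

(** * Noncrossing involutions with cubic vertices, and binary trees *)

Section CubicInvolutions.
Variable N : nat.
Implicit Types (a : {perm 'I_N.+1}) (i j : 'I_N.+1).

(** The tree half of a code: [a] reverses the darts of tree edges and fixes the others, the cycles
    of [a * succp N] are the vertices, and the last clause puts the root dart off the tree. *)
Definition rooted_cubic a :=
  [&& [forall i, a (a i) == i], noncrossing a,
      [forall i, #|porbit (a * succp N) i| == 3] & a ord0 == ord0].

(* The extra position [N.+1] closes a parenthesis opened at the root [0], so
   that [closing a] is the matching of the contour word of a binary tree. *)
Definition closing a k :=
  if k == 0 then N.+1 else if k == N.+1 then 0 else a (inord k) : nat.

(** Identifies the darts with the positions of the closed contour word other than 0; the root goes
    to the closing parenthesis. *)
Definition unroot i : nat := if i == ord0 then N.+1 else i.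

Lemma unroot_bounds i : 0 < unroot i < N.+2.
Proof.
rewrite /unroot; case: eqVneq => [_|]; first lia.
by rewrite -val_eqE /=; have := ltn_ord i; lia.
Qed.

Lemma unroot_inj : injective unroot.
Proof.
move=> i j; rewrite /unroot; case: eqVneq => [->|_]; case: eqVneq => [->|_] //.
- by move=> e; have := ltn_ord j; rewrite -e ltnn.
- by move=> e; have := ltn_ord i; rewrite e ltnn.
exact: val_inj.
Qed.

Lemma unroot_surj k : 0 < k < N.+2 -> exists i, unroot i = k.
Proof.
case/andP=> k0 lt_k; have [->|ne] := eqVneq k N.+1.
  by exists ord0; rewrite /unroot eqxx.
have lt_k' : k < N.+1 by lia.
exists (Ordinal lt_k'); rewrite /unroot ifF //.
by apply/negP=> /eqP/(congr1 val)/=; lia.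
Qed.

Section Closing.
Variable a : {perm 'I_N.+1}.
Hypotheses (aK : involutive a) (a0 : a ord0 = ord0).

Lemma closing0 : closing a 0 = N.+1. Proof. by []. Qed.

Lemma closing_last : closing a N.+1 = 0.
Proof. by rewrite /closing /= eqxx. Qed.

Lemma closing_ord i : i != ord0 -> closing a i = a i.
Proof.
move=> ne; rewrite /closing -[_ == 0]/(i == ord0) (negPf ne) ifF ?inord_val //.
by have := ltn_ord i; lia.
Qed.

Lemma closing_image i : i != ord0 -> 0 < a i < N.+1.
Proof.
move=> ne; rewrite ltn_ord andbT lt0n; apply: contraNneq ne => ai.
by rewrite -(inj_eq (@perm_inj _ a)) a0; apply/eqP/val_inj.
Qed.

Lemma closing_inv : involutive_below N.+2 (closing a).
Proof.
move=> k lt_k; have [->|k0] := eqVneq k 0; first by rewrite closing0 closing_last; lia.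
have [->|kN] := eqVneq k N.+1; first by rewrite closing_last closing0; lia.
have [i ei] : exists i : 'I_N.+1, k = i.
  by exists (inord k); rewrite inordK //; lia.
have ne : i != ord0 by rewrite -val_eqE /= -ei.
have := closing_image ne => ai; rewrite ei closing_ord // closing_ord ?aK; first lia.
by rewrite -val_eqE /=; lia.
Qed.

(** The added arc joins the two extreme positions, hence encloses everything and crosses nothing. *)
Lemma closing_nc : noncrossing a <-> noncrossing_below N.+2 (closing a).
Proof.
split=> [/noncrossingP nc i j lt_i ij|nc]; last first.
  apply/noncrossingP=> i j ij ji.
  have i0 : i != ord0 by apply/eqP=> e; move: ji; rewrite e a0.
  have j0 : j != ord0 by rewrite -val_eqE /=; lia.
  have := nc i j (ltn_trans (ltn_ord i) (leqnn _)) ij.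
  by rewrite !closing_ord //; apply.
have [->|i0] := eqVneq i 0.
  rewrite closing0 => lt_j.
  have j0 : Ordinal lt_j != ord0 by rewrite -val_eqE /=; lia.
  by have := closing_image j0; rewrite -(closing_ord j0).
have [->|iN] := eqVneq i N.+1; first by rewrite closing_last.
have lt_i' : i < N.+1 by lia.
have i0' : Ordinal lt_i' != ord0 by rewrite -val_eqE /=; lia.
have := closing_ord i0'; rewrite /= => -> lt_j.
have lt_j' : j < N.+1 by have := ltn_ord (a (Ordinal lt_i')); lia.
have j0' : Ordinal lt_j' != ord0 by rewrite -val_eqE /=; lia.
have := closing_ord j0'; rewrite /= => ->.
exact: (nc (Ordinal lt_i') (Ordinal lt_j')).
Qed.

(** [unroot] conjugates the rotation to [closing a] followed by a plain successor: the wrap-around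
    from [N] to 0 becomes the step from [N] to [N.+1]. *)
Lemma closing_step i : 0 < N ->
  unroot ((a * succp N)%g i) = (closing a (unroot i)).+1.
Proof.
move=> N0; rewrite permM /unroot; have [->|ne] := eqVneq i ord0.
  rewrite a0 closing_last ifF; first by rewrite succp_lt.
  by rewrite -val_eqE /= succp_lt.
rewrite closing_ord //; have := closing_image ne => ai.
have [aN|aN] := eqVneq (a i : nat) N.
  by rewrite ifT ?aN // -val_eqE /= succp_max.
have aN' : a i < N by lia.
by rewrite -val_eqE /= succp_lt.
Qed.

Lemma closing_cubic : 0 < N ->
  [forall i, #|porbit (a * succp N) i| == 3] <-> cubic_below N.+2 (closing a).
Proof.
move=> N0; have E i : (#|porbit (a * succp N) i| == 3) =
  ((closing a (closing a (closing a (unroot i)).+1).+1).+1 == unroot i)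
    && ((closing a (unroot i)).+1 != unroot i).
  by rewrite card_porbit_eq3 -!(inj_eq unroot_inj) /= !closing_step.
split=> [/forallP c k /unroot_surj[i <-]|c].
  by have := c i; rewrite E => /andP[/eqP-> /eqP].
apply/forallP=> i; rewrite E; have [-> ne] := c _ (unroot_bounds i).
by rewrite eqxx /=; apply/eqP.
Qed.

End Closing.

(** The first and last letters are matched together, so the matching restricts to the positions
    between them; it is extended by fixing 0. *)
Lemma tree_involution t : tlen t = N.+2 ->
  exists a, [/\ involutive a, a ord0 = ord0
    & forall k, k < N.+2 -> tmate t k = closing a k].
Proof.
move=> len; pose f i := if i == ord0 then i else inord (tmate t i) : 'I_N.+1.
have bnd i : i != ord0 -> 0 < tmate t i < N.+1.
  rewrite -val_eqE /= => ne; have [|lt_m e_m] := @tmate_inv t i.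
    by rewrite len; have := ltn_ord i; lia.
  have := @tmate_lt_last t i; rewrite len; have := ltn_ord i.
  have [e|] := eqVneq (tmate t i) 0; last lia.
  by move: e_m; rewrite e tmate0 len; lia.
have fK : involutive f.
  move=> i; rewrite /f; case: (eqVneq i ord0) => [->|ne]; first by rewrite eqxx.
  have b := bnd i ne; rewrite ifF; last by rewrite -val_eqE /= inordK; lia.
  have [|_ e_m] := @tmate_inv t i; first by rewrite len; have := ltn_ord i; lia.
  apply: val_inj => /=; rewrite (@inordK _ (tmate t i)) ?e_m ?inordK //.
  by case/andP: b.
exists (perm (inv_inj fK)); split=> [i||k lt_k]; rewrite ?permE ?fK //.
rewrite /closing; have [->|k0] := eqVneq k 0; first by rewrite tmate0 len.
have [->|kN] := eqVneq k N.+1.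
  have [_] := @tmate_inv t 0 (tlen_gt0 t).
  by rewrite tmate0 len.
rewrite permE /f ifF; last by rewrite -val_eqE /= inordK; lia.
have k_lt : k < N.+1 by lia.
have := bnd (Ordinal k_lt); rewrite -val_eqE /= => /(_ k0) b.
by rewrite !inordK; lia.
Qed.

(** A contour with [m] nodes has [3 * m + 1] letters, which is [N.+2], the number of positions of
    [closing a]. *)
Lemma card_rooted_cubic m : N.+1 = 3 * m ->
  #|[set a | rooted_cubic a]| = catalan m.
Proof.
move=> Nm; have N0 : 0 < N by lia.
apply: (@card_trees_in_bij _ _ _ (fun t a =>
  a ord0 = ord0 /\ forall k, k < N.+2 -> tmate t k = closing a k)).
- move=> t mt; have len : tlen t = N.+2 by rewrite tlenE; lia.
  have [a [aK a0 e]] := tree_involution len; exists a => //.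
  have eqb k : k < N.+2 -> closing a k = tmate t k by move=> /e ->.
  rewrite inE /rooted_cubic a0 eqxx andbT; apply/and3P; split.
  + by apply/forallP=> i; rewrite aK.
  + apply/(closing_nc a0) => i j lt_i ij.
    rewrite eqb // => lt_j; rewrite eqb; first by apply: tmate_nc; rewrite ?len.
    by have [] := @tmate_inv t i; rewrite ?len //; lia.
  apply/(closing_cubic a0 N0) => i lt_i.
  have [c1 c2] := @tmate_cubic t i ltac:(by rewrite len).
  have h1 := @tmate_lt_last t i ltac:(by rewrite len).
  have h2 := @tmate_lt_last t (tmate t i).+1 ltac:(lia).
  by rewrite eqb ?eqb ?eqb //; lia.
- move=> a; rewrite inE => /and4P[/forallP aK nc c /eqP a0].
  have {}aK : involutive a by move=> i; apply/eqP/aK.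
  have [|t len e] := @tmate_decode N.+2 (closing a) (closing_inv aK a0)
      ((closing_nc a0).1 nc) ((closing_cubic a0 N0).1 c) 0 N.+1 (leqnn _).
    by [].
  exists t; first by move: len; rewrite tlenE; lia.
  by split=> // k lt_k; rewrite -[k]add0n e // len; lia.
- move=> t a b [a0 ea] [b0 eb]; apply/permP=> i.
  have [->|ne] := eqVneq i ord0; first by rewrite a0 b0.
  apply: val_inj => /=; rewrite -(closing_ord _ ne) -(closing_ord b ne).
  by rewrite -ea -?eb //; have := ltn_ord i; lia.
move=> t u a mt mu [_ et] [_ eu]; apply: tmate_inj; first by rewrite !tlenE mt mu.
by move=> i; rewrite tlenE mt => lt_i; rewrite et ?eu //; lia.
Qed.

End CubicInvolutions.

(** * Noncrossing matchings with a given support *)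

Section Matchings.
Variable N : nat.
Variable A : {set 'I_N.+1}.
Implicit Types (b : {perm 'I_N.+1}) (i j x : 'I_N.+1).

Definition planar_matching b :=
  [&& [forall i, b (b i) == i], noncrossing b & moved b == A].

(** [F] lists [A] in increasing order and [r] is the rank in [A]; [F] is only of interest below
    [#|A|], where the default is not reached. *)
Let F p := nth ord0 (enum A) p.
Let r x := index x (enum A).

Lemma nth_enum_mem p : p < #|A| -> F p \in A.
Proof. by move=> lt_p; rewrite -mem_enum mem_nth // -cardE. Qed.

Lemma index_enum_lt x : x \in A -> r x < #|A|.
Proof. by move=> xA; rewrite cardE index_mem mem_enum. Qed.

Lemma index_enumK x : x \in A -> F (r x) = x.
Proof. by move=> xA; rewrite /F nth_index ?mem_enum. Qed.

Lemma nth_enumK p : p < #|A| -> r (F p) = p.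
Proof. by move=> lt_p; rewrite /r index_uniq ?enum_uniq // -cardE. Qed.

Lemma ltn_nth_enum p q : p < #|A| -> q < #|A| -> (F p < F q) = (p < q).
Proof.
move=> lt_p lt_q; have s_A : sorted ltn (map val (enum A)).
  rewrite sorted_map {1}/enum_mem; apply: sorted_filter; first exact: ltn_trans.
  by rewrite -(@sorted_map _ _ val ltn) -enumT val_enum_ord iota_ltn_sorted.
have mono k l : k < #|A| -> l < #|A| -> k < l -> F k < F l.
  move=> lt_k lt_l kl; have := sorted_ltn_nth ltn_trans 0 s_A.
  move=> /(_ k l); rewrite !inE size_map -cardE !(nth_map ord0) -?cardE //.
  exact.
have [|le_qp] := ltnP p q; first exact: mono.
have [e|ne] := eqVneq q p; first by rewrite e ltnn.
by have := mono q p lt_q lt_p ltac:(lia); lia.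
Qed.

(** Crossings depend only on the relative order of the matched points, so renumbering [A] by rank
    reduces to the matchings of Dyck words. *)
Lemma card_planar_matching k : #|A| = k.*2 ->
  #|[set b | planar_matching b]| = catalan k.
Proof.
move=> cA; apply: (@card_trees_in_bij _ _ _ (fun u b => moved b = A /\
  forall p, p < #|A| -> b (F p) = F (dmate u p))).
- move=> u ku; pose f x := if x \in A then F (dmate u (r x)) else x.
  have inv := @dmate_inv u; rewrite ku -cA in inv.
  have fF p : p < #|A| -> f (F p) = F (dmate u p).
    by move=> lt_p; rewrite /f nth_enum_mem // nth_enumK.
  have fK : involutive f.
    move=> x; case: (boolP (x \in A)) => xA; last by rewrite /f (negPf xA) (negPf xA).
    rewrite -(index_enumK xA) fF ?index_enum_lt //.
    have [lt_d e_d] := inv _ (index_enum_lt xA).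
    by rewrite fF // e_d.
  have fN x : (f x != x) = (x \in A).
    case: (boolP (x \in A)) => xA; last by rewrite /f (negPf xA) eqxx.
    have lt_x := index_enum_lt xA.
    have [lt_d _] := inv _ lt_x.
    rewrite -{1 2}(index_enumK xA) fF //; apply/eqP=> /(congr1 r).
    by rewrite !nth_enumK //; apply: dmate_nofix; rewrite ku -cA.
  exists (perm (inv_inj fK)); last first.
    split; last by move=> p lt_p; rewrite permE fF.
    by apply/setP=> x; rewrite inE permE fN.
  rewrite inE; apply/and3P; split.
  + by apply/forallP=> x; rewrite !permE fK.
  + apply/noncrossingP=> i j; rewrite !permE => ij ji.
    case: (boolP (j \in A)) => jA; last by rewrite {1 2}/f (negPf jA) ij.
    have iA : i \in A by rewrite -fN -val_eqE /=; lia.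
    have lt_i := index_enum_lt iA; have lt_j := index_enum_lt jA.
    have [lt_di _] := inv _ lt_i; have [lt_dj _] := inv _ lt_j.
    move: ij ji; rewrite -(index_enumK iA) -(index_enumK jA) !fF // !ltn_nth_enum //.
    by apply: dmate_nc; rewrite ku -cA.
  by apply/eqP/setP=> x; rewrite inE permE fN.
- move=> b; rewrite inE => /and3P[/forallP bK nc /eqP mb].
  have {}bK : involutive b by move=> i; apply/eqP/bK.
  have memA x : (x \in A) = (b x != x) by rewrite -mb inE.
  have bA x : x \in A -> b x \in A by rewrite !memA bK eq_sym.
  pose e p := r (b (F p)).
  have eF p : p < #|A| -> F (e p) = b (F p).
    by move=> lt_p; rewrite index_enumK // bA // nth_enum_mem.
  have e_lt p : p < #|A| -> e p < #|A|.
    by move=> lt_p; rewrite index_enum_lt // bA // nth_enum_mem.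
  have e_inv : involutive_below #|A| e.
    by move=> p lt_p; rewrite e_lt // /e index_enumK ?bK ?nth_enumK ?bA ?nth_enum_mem.
  have e_nc : noncrossing_below #|A| e.
    move=> p q lt_p pq qe; have lt_q := ltn_trans qe (e_lt p lt_p).
    rewrite -(@ltn_nth_enum p) ?e_lt // -(@ltn_nth_enum (e q)) ?e_lt // !eF //.
    by apply: (noncrossingP _ nc); rewrite -?eF // ltn_nth_enum ?e_lt.
  have e_nf p : p < #|A| -> e p <> p.
    move=> lt_p /(congr1 F); rewrite eF //; apply/eqP.
    by rewrite -memA nth_enum_mem.
  have [||u ku eu] := dmate_decode e_inv e_nc e_nf (p := 0) (q := #|A|).
  + by rewrite leqnn.
  + by move=> i; apply: e_lt.
  exists u; first by apply: double_inj; rewrite ku cA subn0.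
  split=> // p lt_p; rewrite -eF //; congr F.
  by have := eu p; rewrite subn0 add0n; apply.
- move=> u b c [mb eb] [mc ec]; apply/permP=> x.
  case: (boolP (x \in A)) => xA.
    by rewrite -(index_enumK xA) eb ?ec ?index_enum_lt.
  move: (xA); rewrite -{1}mb inE negbK => /eqP->.
  by move: xA; rewrite -mc inE negbK => /eqP->.
move=> t u b kt ku [_ et] [_ eu]; apply: dmate_inj; first by rewrite kt ku.
rewrite kt -cA => p lt_p.
have [lt_t _] := @dmate_inv t p ltac:(by rewrite kt -cA).
have [lt_u _] := @dmate_inv u p ltac:(by rewrite ku -cA).
rewrite kt -cA in lt_t; rewrite ku -cA in lt_u.
by rewrite -[LHS]nth_enumK // -et // eu // nth_enumK.
Qed.

End Matchings.

Definition contour_codes N : {set {perm 'I_N.+1} * {perm 'I_N.+1}} :=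
  [set ab | rooted_cubic ab.1 && planar_matching (~: moved ab.1) ab.2].

(** The vertices are counted twice: by the noncrossing formula and by their degree. *)
Lemma card_moved_rooted_cubic N (a : {perm 'I_N.+1}) : rooted_cubic a ->
  3 * (#|moved a| + 2) = 2 * N.+1.
Proof.
case/and4P=> /forallP aK nc /forallP c _.
have {}aK : involutive a by move=> i; apply/eqP/aK.
have := noncrossing_porbits aK nc.
have := @card_porbits_uniform _ (a * succp N)%g 3 (fun x => eqP (c x)).
by rewrite card_ord; lia.
Qed.

(** Every admissible [a] moves [4 * n - 2] darts. The number of [b] is then the same for all [a],
    since [2 * n + 2] darts are left to match. *)
Lemma card_contour_codes n N : N.+1 = 6 * n ->
  #|contour_codes N| = catalan (2 * n) * catalan (n + 1).
Proof.
move=> N6n; rewrite -sum1_card.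
rewrite (eq_bigl (fun ab : {perm 'I_N.+1} * {perm 'I_N.+1} =>
  rooted_cubic ab.1 && planar_matching (~: moved ab.1) ab.2)); last first.
  by move=> ab; rewrite inE.
rewrite -(pair_big_dep (fun a : {perm 'I_N.+1} => rooted_cubic a)
  (fun a b : {perm 'I_N.+1} => planar_matching (~: moved a) b) (fun _ _ => 1)) /=.
rewrite (eq_bigr (fun=> catalan (n + 1))) => [|a ra].
  by rewrite sum_nat_cond_const (@card_rooted_cubic N (2 * n)) //; lia.
rewrite sum1dep_card; apply: card_planar_matching.
have := card_moved_rooted_cubic ra; have := cardsC (moved a).
by rewrite card_ord; lia.
Qed.

(** * The walk around a spanning tree *)

Section Walks.
Variable M : cmap.
Implicit Types (d x y : dart M) (A B : {set {set dart M}}).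

Lemma edge_opp d : edge (opp M d) = edge d.
Proof. exact: porbit_perm1. Qed.

Lemma mem_edge x y : (x \in edge y) = (x == y) || (x == opp M y).
Proof.
apply/idP/orP => [|[] /eqP->]; last first.
- by rewrite -edge_opp; apply: porbit_id.
- exact: porbit_id.
apply: (@porbit_ind _ _ (fun x => x == y \/ x == opp M y)); first by left.
by move=> z [] /eqP->; [right|left]; rewrite ?oppK.
Qed.

Lemma card_edge d : #|edge d| = 2.
Proof.
have -> : edge d = [set d; opp M d] by apply/setP=> x; rewrite mem_edge !inE.
by rewrite cards2 eq_sym opp_neq.
Qed.

Lemma eq_edge x y : edge x = edge y -> x = y \/ x = opp M y.
Proof.
by move/eqP; rewrite eq_porbit_mem mem_edge => /orP[] /eqP; [left|right].
Qed.

Lemma edge_in_edges d : edge d \in edges M.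
Proof. exact: mem_porbits. Qed.

Lemma origin_rot d : origin (Defs.rot M d) = origin d.
Proof. exact: porbit_perm1. Qed.

Lemma origin_closed (X : Type) (g : dart M -> X) x y :
  (forall z, g (Defs.rot M z) = g z) -> origin x = origin y -> g x = g y.
Proof.
by move=> g_rot /eqP; rewrite eq_porbit_mem; apply: porbit_closed.
Qed.

Definition flip_fun A d := if edge d \in A then opp M d else d.

Lemma flip_funK A : involutive (flip_fun A).
Proof.
move=> d; rewrite /flip_fun; case: (boolP (edge d \in A)) => dA.
  by rewrite edge_opp dA oppK.
by rewrite (negPf dA).
Qed.

Definition flip A : {perm dart M} := perm (inv_inj (flip_funK A)).

Lemma flipE A d : flip A d = if edge d \in A then opp M d else d.
Proof. by rewrite permE. Qed.

Lemma flipK A : involutive (flip A).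
Proof. by move=> d; rewrite !permE flip_funK. Qed.

Lemma mem_moved_flip A d : (d \in moved (flip A)) = (edge d \in A).
Proof. by rewrite inE flipE; case: ifP => _; rewrite ?opp_neq ?eqxx. Qed.

(* [tour A] follows the boundary of a thickening of the subgraph [A]. *)
Definition tour A : {perm dart M} := (flip A * Defs.rot M)%g.

Lemma tourE A d : tour A d = Defs.rot M (flip A d).
Proof. by rewrite permM. Qed.

Lemma flip_cut A d : edge d \in A -> flip (A :\ edge d) = cut (flip A) d.
Proof.
move=> dA; apply/permP=> z; rewrite cutE; last exact: flipK.
rewrite !flipE dA -mem_edge !inE -eq_porbit_mem.
by case: (_ == _) => //=; rewrite andbF.
Qed.

(** Adding an edge changes the tour by one transposition, so cycles can be counted edge by edge. *)
Lemma tour_tperm A d : edge d \in A ->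
  tour A = (tperm d (opp M d) * tour (A :\ edge d))%g.
Proof.
move=> dA; rewrite /tour flip_cut //.
have := tperm_cut (flip A) d (Defs.rot M); rewrite {1}flipE dA => <-.
by [].
Qed.

Lemma tour_connect A x y :
  y \in porbit (tour A) x -> connect (adj A) (origin x) (origin y).
Proof.
apply: (@porbit_ind _ _ (fun y => connect (adj A) (origin x) (origin y))).
  exact: connect0.
move=> z xz; apply: connect_trans xz _; rewrite tourE origin_rot flipE.
case: ifP => zA; last exact: connect0.
by apply: connect1; apply/existsP; exists z; rewrite zA !eqxx.
Qed.

(** Chooses a dart for each step: [connect] speaks of vertices, [graph_cycle] of darts. *)
Lemma walk_darts A v p : path (adj A) v p ->
  exists q : seq (dart M), [/\ all (fun d => edge d \in A) q,
    map (@origin M) q = belast v p & map (@target M) q = p].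
Proof.
elim: p v => [|w p IHp] v /=; first by exists [::].
case/andP=> /existsP[d /and3P[dA /eqP od /eqP td]] /IHp[q [qA oq tq]].
by exists (d :: q); rewrite /= dA qA od oq td tq.
Qed.

Lemma walk_cycle q v p d d0 : target d0 = v -> map (@origin M) q = belast v p ->
    map (@target M) q = p -> last v p = origin d ->
  path [rel x y | target x == origin y] d0 (rcons q d).
Proof.
elim: q v p d0 => [|x q IHq] v [|w p] d0 //=; first by move=> -> _ _ ->; rewrite eqxx.
by move=> -> [-> oq] [tx tq] lastp; rewrite eqxx /=; apply: (IHq w p).
Qed.

(** Using an edge again, in either direction, would revisit one of its ends. *)
Lemma walk_edges_uniq q v p : uniq (v :: p) -> map (@origin M) q = belast v p ->
  map (@target M) q = p -> uniq (map (@edge M) q).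
Proof.
elim: q v p => [|x q IHq] v [|w p] //= /andP[nv uwp] [ox oq] [tx tq].
rewrite (IHq w p) // andbT; apply/mapP=> -[y yq /eq_edge exy].
have ty : target y \in p by rewrite -tq map_f.
move: uwp nv => /andP[nw _]; rewrite inE => /norP[_ nv].
case: exy => e; first by move: nw; rewrite -tx e ty.
by move: nv; rewrite -ox e -/(target y) ty.
Qed.

(** Otherwise a path without repeated vertices, avoiding the edge of [d], would close up with [d]
    into a cycle. *)
Lemma acyclic_disconnects A d : acyclic A -> edge d \in A ->
  ~~ connect (adj (A :\ edge d)) (target d) (origin d).
Proof.
move=> acA dA; apply/negP=> /connectP[p0 path_p0].
case/shortenP: path_p0 => p path_p uniq_p _ last_p.
have [q [qA oq tq]] := walk_darts path_p.
have := acA (d :: q); rewrite /= dA => /(_ _)/negP; apply; last first.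
  by apply: sub_all qA => x; rewrite inE => /andP[].
apply/and4P; split=> //.
- exact: (walk_cycle (erefl _) oq tq).
- have := uniq_p; rewrite lastI rcons_uniq -last_p /= => /andP[no ub].
  by rewrite oq no ub.
rewrite /= (walk_edges_uniq uniq_p oq tq) andbT.
apply/mapP=> -[x /(allP qA)]; rewrite !inE => /andP[ne _] e.
by rewrite e eqxx in ne.
Qed.

Lemma acyclic_sub A B : B \subset A -> acyclic A -> acyclic B.
Proof.
move=> sBA acA p /acA; apply: contra; apply: sub_all => x.
exact: (subsetP sBA).
Qed.

(** Induction on the number of edges. The ends of a removed edge are disconnected, so they lie on
    different tours, and restoring the edge merges these two. The last two clauses say that a tour
    is a union of vertices and follows both sides of its edges. *)
Lemma tour_forest A : A \subset edges M -> acyclic A ->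
  [/\ #|porbits (tour A)| + #|A| = #|vertices M|,
      #|moved (flip A)| = #|A|.*2,
      forall x, porbit (tour A) (Defs.rot M x) = porbit (tour A) x
    & forall x, edge x \in A -> porbit (tour A) (opp M x) = porbit (tour A) x].
Proof.
have [k] := ubnP #|A|; elim: k A => // k IH A le_k sA acA.
have [A0|[e eA]] := set_0Vmem A.
  have flip1 : flip A = 1%g.
    by apply/permP=> x; rewrite flipE A0 inE perm1.
  have tour1 : tour A = Defs.rot M by rewrite /tour flip1 mul1g.
  rewrite tour1 flip1 A0 cards0 addn0; split=> // [|x|x]; last by rewrite inE.
    by apply/eqP; rewrite cards_eq0; apply/eqP/setP=> x; rewrite !inE perm1 eqxx.
  exact: porbit_perm1.
have [d _ ed] := imsetP (subsetP sA e eA); rewrite -/(edge d) in ed.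
have dA : edge d \in A by rewrite -ed.
have := cardsD1 (edge d) A; rewrite dA add1n => cA.
have [|||cnt mov r_rot r_opp] := IH (A :\ edge d).
- by move: le_k; rewrite cA ltnS.
- exact: subset_trans (subD1set _ _) sA.
- exact: acyclic_sub (subD1set _ _) acA.
have nin : d \notin porbit (tour (A :\ edge d)) (opp M d).
  by apply: contra (acyclic_disconnects acA dA); apply: tour_connect.
have [cnt' same merge] := porbit_merge nin.
rewrite -tour_tperm // in cnt' same merge.
have sub x y : porbit (tour (A :\ edge d)) x = porbit (tour (A :\ edge d)) y ->
    porbit (tour A) x = porbit (tour A) y.
  by move/eqP; rewrite eq_porbit_mem; apply: porbit_closed.
have fd : flip A d != d by rewrite flipE dA opp_neq.
split=> [||x|x xA].
- by rewrite -cnt -cnt' cA addnS.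
- by rewrite (moved_cut (@flipK A) fd) -flip_cut // mov cA doubleS addn2.
- by apply: sub; rewrite r_rot.
have [exd|nxd] := eqVneq (edge x) (edge d).
  by have [->|->] := eq_edge exd; rewrite ?oppK same.
by apply: sub; apply: r_opp; rewrite !inE nxd.
Qed.

(** The tour through a dart is unchanged by turning at a vertex or crossing a tree edge;
    connectedness makes it unique. *)
Lemma spanning_tree_tour A : spanning_tree A -> forall x y,
  porbit (tour A) x = porbit (tour A) y.
Proof.
case=> sA conA acA x y; have [_ _ r_rot r_opp] := tour_forest sA acA.
have /connectP[p path_p last_p] := conA _ _ (mem_porbits _ x) (mem_porbits _ y).
have same u v : origin u = origin v -> porbit (tour A) u = porbit (tour A) v.
  exact: origin_closed.
move: last_p path_p; rewrite -!/(origin _).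
elim: p x => [|w p IHp] x /=; first by move=> /esym/same.
move=> last_p /andP[/existsP[d /and3P[dA /eqP od /eqP td]] path_p].
rewrite -(same d x) // -r_opp //; apply: IHp; rewrite -/(target d) td //.
Qed.

Lemma spanning_tree_card A : 0 < #|dart M| -> spanning_tree A ->
  [/\ #|A|.+1 = #|vertices M|, #|moved (flip A)| = #|A|.*2
    & forall x, porbit (tour A) x = setT].
Proof.
move=> /card_gt0P[x0 _] tA; have one := spanning_tree_tour tA.
have [sA _ acA] := tA; have [cnt mov _ _] := tour_forest sA acA.
split=> // [|x]; last first.
  by apply/setP=> y; rewrite -eq_porbit_mem (one y x) eqxx inE.
rewrite -cnt (_ : porbits _ = [set porbit (tour A) x0]) ?cards1 //.
by apply/setP=> B; rewrite inE; apply/imsetP/eqP => [[x _ ->]|->]; last exists x0.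
Qed.

(** If [I] is constant on vertices and across the edges of [q], the walk [q] cannot change sides.
    This serves to refute cycles in the tree of a code. *)
Lemma cycle_side (I : dart M -> bool) d0 d (q : seq (dart M)) :
    (forall z, I (Defs.rot M z) = I z) ->
    {in q, forall y, I (opp M y) = I y} ->
    path [rel x y | target x == origin y] d0 (rcons q d) ->
  I (opp M d0) = I d.
Proof.
move=> I_rot; elim: q d0 => [|x q IHq] d0 I_opp /= /andP[/eqP tx].
  by move=> _; apply: (origin_closed I_rot).
move=> /IHq <- => [|y yq]; last by apply: I_opp; rewrite inE yq orbT.
by rewrite (I_opp x) ?mem_head //; apply: (origin_closed I_rot).
Qed.

Lemma card_edges : #|dart M| = #|edges M| * 2.
Proof. by apply: card_porbits_uniform => x; apply: card_edge. Qed.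

End Walks.

(** * The map of a pair of involutions *)

Section CodeMap.
Variables (N : nat) (ab : {perm 'I_N.+1} * {perm 'I_N.+1}).
Hypothesis abP : ab \in contour_codes N.
Let a := ab.1.
Let b := ab.2.
Implicit Types i j x y : 'I_N.+1.

Lemma code_cubic : rooted_cubic a.
Proof. by move: abP; rewrite inE => /andP[]. Qed.

Lemma code_aK : involutive a.
Proof. by case/and4P: code_cubic => /forallP aK _ _ _ x; apply/eqP/aK. Qed.

Lemma code_matching : planar_matching (~: moved a) b.
Proof. by move: abP; rewrite inE => /andP[]. Qed.

Lemma code_bK : involutive b.
Proof. by case/and3P: code_matching => /forallP bK _ _ x; apply/eqP/bK. Qed.

Lemma code_moved x : (b x != x) = (a x == x).
Proof.
by case/and3P: code_matching => _ _ /eqP/setP/(_ x); rewrite !inE negbK.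
Qed.

Lemma code_oppE x : (a * b)%g x = if a x == x then b x else a x.
Proof.
rewrite permM; case: eqVneq => [->|ax] //.
by apply/eqP; rewrite -[_ == _]negbK code_moved code_aK eq_sym.
Qed.

Lemma code_oppK : involutive (a * b)%g.
Proof.
move=> x; rewrite [(a * b)%g x]code_oppE; case: eqVneq => ax.
  rewrite permM; have bx : b x != x by rewrite code_moved ax.
  have /eqP-> : a (b x) == b x by rewrite -code_moved code_bK eq_sym.
  exact: code_bK.
rewrite permM code_aK; apply/eqP; rewrite -[_ == _]negbK code_moved.
exact: ax.
Qed.

Lemma code_opp_neq x : (a * b)%g x != x.
Proof. by rewrite code_oppE; case: ifP => [|/negbT]; rewrite -?code_moved. Qed.

(** Starting the rotation with [a] makes the tour of the tree equal to the successor, since [a]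
    cancels. *)
Definition code_cmap : cmap := CMap (a * succp N)%g code_oppK code_opp_neq.

Definition code_map : marked_map :=
  @MarkedMap code_cmap [set @edge code_cmap x | x in moved a] ord0.

Lemma code_mtree (x : dart code_map) : (edge x \in mtree code_map) = (a x != x).
Proof.
apply/imsetP/idP => [[y ya]|ax]; last by exists x; rewrite ?inE.
rewrite inE in ya; case/eq_edge=> ->; first by [].
by rewrite /= code_oppE (negPf ya) code_aK eq_sym.
Qed.

Lemma code_flip (x : dart code_map) : flip (mtree code_map) x = a x.
Proof.
by rewrite flipE code_mtree /= code_oppE; case: eqVneq.
Qed.

Lemma code_tour (x : dart code_map) : tour (mtree code_map) x = succp N x.
Proof. by rewrite tourE code_flip /= permM code_aK. Qed.

Lemma code_connected : connected_by (mtree code_map).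
Proof.
move=> _ _ /imsetP[x _ ->] /imsetP[y _ ->]; apply: tour_connect.
have ->: tour (mtree code_map) = succp N by apply/permP=> z; exact: code_tour.
by rewrite -eq_porbit_mem -[x]succp_iterE -[y]succp_iterE -!permX !porbit_perm.
Qed.

(** The transposition of [d] and [a d] followed by the successor preserves the interval, and so do
    the other arcs because they do not cross this one. *)
Lemma code_side (d x : 'I_N.+1) (I := fun x : 'I_N.+1 => d < x <= a d) :
  d < a d -> (I ((a * succp N)%g x) = I x) * (x != d -> x != a d -> I (a x) = I x).
Proof.
move=> lt_d; have ad : a d != d by rewrite neq_ltn lt_d orbT.
have side y : y != d -> y != a d -> I (a y) = I y.
  move=> yd yad; have ayd : a y != d by rewrite -(inj_eq (@perm_inj _ a)) code_aK.
  have ayad : a y != a d by rewrite (inj_eq perm_inj).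
  case/and4P: code_cubic => _ /noncrossingP nc _ _.
  have := nc d y; have := nc d (a y); rewrite code_aK /I.
  by move: yd yad ayd ayad; rewrite -!val_eqE /=; lia.
split; last exact: side.
rewrite permM; have e : a x = tperm d (a d) (cut a d x).
  have := cut_tperm d code_aK 1; rewrite !mulg1 => /permP/(_ x) <-.
  by rewrite permM.
rewrite e {1}/I tperm_succp_interval // -/(I _) cutE; last exact: code_aK.
by case: ifP => // /norP[xd xad]; apply: side.
Qed.

(* The darts strictly after one end of a tree edge and up to its other end form
   a union of vertices, and the noncrossing condition says that no other tree
   edge leaves it. *)
Lemma code_acyclic : acyclic (mtree code_map).
Proof.
case=> [|d q] // /and4P[_ cyc _]; rewrite /= => /andP[nd _].
apply/negP=> /andP[dA qA]; have {}dA : a d != d by rewrite -code_mtree.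
have opp_d : opp code_map d = a d by rewrite /= code_oppE (negPf dA).
(* The arc is named by its left end, which may be either dart of the edge. *)
have [l lt_l set_l] :
    exists2 l : 'I_N.+1, l < a l & [set l; a l] = [set d; a d].
  have [|le_ad] := ltnP d (a d); first by exists d.
  exists (a d); rewrite code_aK; last by rewrite setUC.
  by rewrite ltn_neqAle le_ad andbT.
have side x := code_side x lt_l.
have := @cycle_side code_map (fun x : 'I_N.+1 => l < x <= a l) d d q.
rewrite opp_d => /(_ (fun x => (side x).1) _ cyc) E.
have {}E : (l < a d <= a l) = (l < d <= a l).
  apply: E => y yq.
  have ay : a y != y by rewrite -code_mtree; apply: (allP qA).
  have -> : opp code_map y = a y by rewrite /= code_oppE (negPf ay).
  have : y \notin [set l; a l].
    rewrite set_l -opp_d inE !in_set1 -mem_edge -eq_porbit_mem.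
    by apply: contraNneq nd => e; rewrite -[edge d]e; apply: map_f.
  by rewrite inE !in_set1 => /norP[]; apply: (side y).2.
have : d \in [set l; a l] by rewrite set_l inE in_set1 eqxx.
rewrite inE !in_set1 => /orP[] /eqP ed; move: E; rewrite ed ?code_aK; lia.
Qed.

Lemma code_spanning_tree : spanning_tree (mtree code_map).
Proof.
split; [|exact: code_connected|exact: code_acyclic].
by apply/subsetP=> _ /imsetP[x _ ->]; apply: edge_in_edges.
Qed.

Lemma code_map_cubic : cubic code_map.
Proof.
move=> _ /imsetP[x _ ->]; case/and4P: code_cubic => _ _ /forallP/(_ x)/eqP c _.
exact: c.
Qed.

Lemma code_card_vertices : #|vertices code_map| * 3 = N.+1.
Proof.
rewrite -(card_ord N.+1) (@card_porbits_uniform _ (a * succp N)%g 3) // => x.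
by case/and4P: code_cubic => _ _ /forallP/(_ x)/eqP.
Qed.

Lemma code_planar : planar code_map.
Proof.
have [_ nca _ _] := and4P code_cubic; have [_ ncb /eqP mb] := and3P code_matching.
have cV : #|vertices code_cmap|.*2 = #|moved a| + 2.
  exact: noncrossing_porbits code_aK nca.
have cF : #|faces code_cmap|.*2 = #|~: moved a| + 2.
  rewrite -mb -(noncrossing_porbits code_bK ncb).
  (* The face permutation [(a * b) * (a * succp N)] is [b * succp N], because [a * b] is an
     involution. *)
  congr (#|pred_of_set (porbits _)|.*2); apply/permP=> x.
  rewrite !permM; congr (succp N _); apply: (@perm_inj _ b).
  by have := code_oppK x; rewrite !permM code_bK => ->.
have := card_edges code_cmap; have := cardsC (moved a).
by rewrite !card_ord /planar; move: cV cF; rewrite /code_map /=; lia.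
Qed.

Lemma code_map_valid : tree_rooted_plane_cubic code_map.
Proof.
split; [|exact: code_planar|exact: code_map_cubic|exact: code_spanning_tree|].
  move=> u v uV vV; have := code_connected uV vV; apply: connect_sub => u' v'.
  case/existsP=> d /and3P[dA od td]; apply: connect1; apply/existsP; exists d.
  by rewrite edge_in_edges od td.
by rewrite code_mtree negbK /=; case/and4P: code_cubic.
Qed.

End CodeMap.

(** * The pair of involutions of a map *)

(** An isomorphism commutes with the tours, which are the successor on both sides, and fixes the
    root 0; hence it is the identity. *)
Lemma code_map_rigid N (ab ab' : {perm 'I_N.+1} * {perm 'I_N.+1})
    (abP : ab \in contour_codes N) (abP' : ab' \in contour_codes N) :
  marked_iso (code_map abP) (code_map abP') -> ab = ab'.
Proof.
case=> f [_ f_rot f_opp f_tree f_root].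
have f_flip x : f (flip (mtree (code_map abP)) x) =
    flip (mtree (code_map abP')) (f x).
  by rewrite !flipE f_tree; case: ifP.
have f_succ x : f (succp N x) = succp N (f x).
  by rewrite -(@code_tour _ _ abP) -(@code_tour _ _ abP') !tourE f_rot f_flip.
have f_id x : f x = x.
  rewrite -[x]succp_iterE; elim: (x : nat) => //= i IHi.
  by rewrite f_succ IHi.
have a_eq : ab.1 = ab'.1.
  apply/permP=> x; have := f_flip x; rewrite f_id (@code_flip _ _ abP) f_id.
  by move=> ->; apply: (@code_flip _ _ abP').
have o_eq : (ab.1 * ab.2 = ab'.1 * ab'.2)%g.
  by apply/permP=> x; have := f_opp x; rewrite !f_id.
have b_eq : ab.2 = ab'.2.
  by apply: (mulgI ab.1); rewrite o_eq a_eq.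
by rewrite [ab]surjective_pairing a_eq b_eq -surjective_pairing.
Qed.

(** * Transport of permutations along a bijection *)

Section Conjugacy.
Variables (T U : finType) (s : {perm T}) (t : {perm U}) (f : T -> U).
Hypotheses (f_bij : bijective f) (fs : forall x, f (s x) = t (f x)).

Lemma porbit_conj x : porbit t (f x) = f @: porbit s x.
Proof.
have fX i : (t ^+ i)%g (f x) = f ((s ^+ i)%g x).
  by rewrite !permX; elim: i => //= i ->; rewrite fs.
apply/setP=> y; apply/porbitP/imsetP => [[i ->]|[_ /porbitP[i ->] ->]].
  by exists ((s ^+ i)%g x); rewrite ?mem_porbit.
by exists i.
Qed.

Lemma card_porbit_conj x : #|porbit t (f x)| = #|porbit s x|.
Proof. by rewrite porbit_conj card_imset //; apply: bij_inj. Qed.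

Lemma card_porbits_conj : #|porbits s| = #|porbits t|.
Proof.
rewrite -(card_imset _ (imset_inj (bij_inj f_bij))).
congr #|pred_of_set _|; apply/setP=> B; have [g fK gK] := f_bij.
apply/imsetP/imsetP => [[_ /imsetP[x _ ->] ->]|[y _ ->]].
  by exists (f x); rewrite // porbit_conj.
by exists (porbit s (g y)); rewrite ?mem_porbits // -porbit_conj gK.
Qed.

Lemma card_moved_conj : #|moved s| = #|moved t|.
Proof.
rewrite -(card_imset _ (bij_inj f_bij)); congr #|pred_of_set _|.
apply/setP=> y; have [g fK gK] := f_bij.
apply/imsetP/idP => [[x xs ->]|]; rewrite inE.
  by rewrite -fs (bij_eq f_bij); rewrite inE in xs.
by move=> ty; exists (g y); rewrite // inE -(bij_eq f_bij) fs gK.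
Qed.

End Conjugacy.

Lemma perm_cycle_labelling (T : finType) (t : {perm T}) (x0 : T) N :
    #|T| = N.+1 -> porbit t x0 = setT ->
  exists f : 'I_N.+1 -> T, [/\ bijective f, f ord0 = x0
    & forall i, f (succp N i) = t (f i)].
Proof.
move=> cT full; pose f (i : 'I_N.+1) := iter i t x0.
have card_full : #|porbit t x0| = N.+1 by rewrite full cardsT.
have f_inj : injective f.
  move=> i j eij; apply: val_inj => /=.
  have := uniq_traject_porbit t x0; rewrite card_full => U.
  have := nth_uniq x0 _ _ U (i := i) (j := j); rewrite size_traject.
  rewrite !ltn_ord !nth_traject // => /(_ isT isT) E.
  by apply/eqP; rewrite -E; apply/eqP.
exists f; split=> //; first by apply: inj_card_bij; rewrite // cT card_ord.
move=> i; rewrite /f; have [iN|iN] := eqVneq (i : nat) N.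
  by rewrite succp_max // -iterS iN -card_full iter_porbit.
by rewrite succp_lt //; have := ltn_ord i; lia.
Qed.

Lemma perm_pullback (T U : finType) (t : {perm U}) (f : T -> U) :
  bijective f -> exists s : {perm T}, forall x, f (s x) = t (f x).
Proof.
case=> g fK gK; have inj : injective (fun x => g (t (f x))).
  by move=> x y /(can_inj gK)/perm_inj/(can_inj fK).
by exists (perm inj) => x; rewrite permE gK.
Qed.

(** The darts are numbered along the tour from the root, and the reversals on and off the tree are
    pulled back. As [code_map] depends on a membership proof, the isomorphism is given for every
    such proof. *)
Lemma code_of_map (n N : nat) (M : marked_map) : N.+1 = 6 * n ->
    tree_rooted_plane_cubic M -> #|vertices M| = 2 * n ->
  exists2 ab, ab \in contour_codes N &
    forall abP : ab \in contour_codes N, marked_iso M (code_map abP).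
Proof.
move=> N6n [_ plM cubM treeM rootM] cV.
have deg3 (x : dart M) : #|origin x| = 3 by apply/cubM/mem_porbits.
have cD : #|dart M| = N.+1.
  by rewrite (card_porbits_uniform deg3) -/(vertices M) cV; lia.
have D0 : 0 < #|dart M| by rewrite cD.
have [cA mA full] := spanning_tree_card D0 treeM.
set A := mtree M in treeM rootM cA mA full.
have [f [f_bij f0 f_succ]] := perm_cycle_labelling cD (full (mroot M)).
have [a fa] : exists a : {perm 'I_N.+1}, forall x, f (a x) = flip A (f x).
  exact: perm_pullback.
have [b fb] : exists b : {perm 'I_N.+1}, forall x, f (b x) = flip (~: A) (f x).
  exact: perm_pullback.
have f_inj := bij_inj f_bij.
have aK : involutive a by move=> x; apply: f_inj; rewrite !fa flipK.
have bK : involutive b by move=> x; apply: f_inj; rewrite !fb flipK.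
have rotE x : f ((a * succp N)%g x) = Defs.rot M (f x).
  by rewrite permM f_succ fa tourE flipK.
have flip_flip x : flip A (flip (~: A) x) = opp M x.
  by rewrite !flipE inE; case: (boolP (edge x \in A)) => [->|/negPf xA] //=;
    rewrite edge_opp xA.
have flip_flip' x : flip (~: A) (flip A x) = opp M x.
  by rewrite !flipE inE; case: (boolP (edge x \in A)) => [xA|/negPf-> //];
    rewrite edge_opp xA.
have faceE x : f ((b * succp N)%g x) = (opp M * Defs.rot M)%g (f x).
  by rewrite permM f_succ fb tourE flip_flip permM.
have ca : #|porbits (a * succp N)| = #|vertices M| by apply: card_porbits_conj rotE.
have cb : #|porbits (b * succp N)| = #|faces M| by apply: card_porbits_conj faceE.
have ma : #|moved a| = #|A|.*2 by rewrite (card_moved_conj f_bij fa).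
have mb : moved b = ~: moved a.
  apply/setP=> x; rewrite !inE -!(inj_eq f_inj) fa fb.
  have := mem_moved_flip A (f x); have := mem_moved_flip (~: A) (f x).
  by rewrite !inE => -> ->.
have cE := card_edges M; rewrite cD in cE.
have cMb := cardsC (moved a); rewrite card_ord -mb in cMb.
have abP : (a, b) \in contour_codes N.
  rewrite inE /=; apply/andP; split; [apply/and4P|apply/and3P]; split.
  - by apply/forallP=> x; rewrite aK.
  (* A spanning tree has one edge fewer than vertices, which is the extremal cycle count. *)
  - by apply: porbits_noncrossing; rewrite // ca ma; lia.
  - by apply/forallP=> x; rewrite -(card_porbit_conj f_bij rotE) deg3.
  - by rewrite -(inj_eq f_inj) fa f0 flipE (negPf rootM).
  - by apply/forallP=> x; rewrite bK.
  (* Euler's formula gives one face more than there are edges off the tree, again the extremal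
     count. *)
  - by apply: porbits_noncrossing; rewrite // cb; move: plM; rewrite /planar; lia.
  by rewrite mb.
exists (a, b) => // {}abP; apply: marked_iso_sym; exists f; split=> //.
- by move=> x; rewrite /= permM fb fa flip_flip'.
move=> x; rewrite (@code_mtree _ _ abP) -(inj_eq f_inj) fa -mem_moved_flip.
by rewrite inE.
Qed.

Theorem mainTheorem1 (n : nat) (n_ge1 : 1 <= n) :
  number_up_to_iso
    (fun M : marked_map =>
       tree_rooted_plane_cubic M /\ #|vertices M| = 2 * n)
    (catalan (2 * n) * catalan (n + 1)).
Proof.
(* There are [6 * n] darts, three at each of the [2 * n] vertices; the successor form makes them a
   nonempty ordinal type. *)
have N6n : (6 * n).-1.+1 = 6 * n by lia.
rewrite -(card_contour_codes N6n).
exists (fun i => code_map (enum_valP i)); split=> [i|i j|M [treeM cV]].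
- split; first exact: code_map_valid.
  by apply/eqP; rewrite -(@eqn_pmul2r 3) // code_card_vertices; lia.
- by move/code_map_rigid/enum_val_inj.
have [ab abP isoM] := code_of_map N6n treeM cV.
(* The membership proof is generalized so that the enumerated element can be rewritten to [ab]. *)
exists (enum_rank_in abP ab); move: (enum_valP _).
by rewrite enum_rankK_in.
Qed.
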